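(* Let $p$ be an odd prime and $l,k$ positive integers. There exist groups $G_1$ and $G_2$ of rank two, neither isomorphic to $C_{p^l}*C_{p^k}$, such that for all $i\geq1$ $$G_1/\gamma_i(G_1)\cong G_2/\gamma_i(G_2)\cong (C_{p^l}*C_{p^k})/\gamma_i(C_{p^l}*C_{p^k}).$$ Moreover $G_1$ is residually nilpotent and $G_2$ is not residually nilpotent.
   Context: $C_m$ denotes the cyclic group of order $m$. Lower central series: $\gamma_1(G)=G$, $\gamma_k(G)=[G,\gamma_{k-1}(G)]$. Residually nilpotent means $\bigcap_k\gamma_k(G)=\{1\}$. Rank is the minimum size of a generating set. *)

(* Defs.v *)
From mathcomp Require Import all_boot.

Set Implicit Arguments.
Unset Strict Implicit.
Unset Printing Implicit Defensive.

Record group := Group {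
  carrier :> Type;
  gmul : carrier -> carrier -> carrier;
  ginv : carrier -> carrier;
  gone : carrier;
  gmulA : forall x y z, gmul x (gmul y z) = gmul (gmul x y) z;
  gmul1 : forall x, gmul gone x = x;
  gmulV : forall x, gmul (ginv x) x = gone
}.

Arguments gmul {g}.
Arguments ginv {g}.
Arguments gone {g}.

Definition gpow (G : group) (x : G) (n : nat) : G := iter n (gmul x) gone.

Definition gcomm (G : group) (x y : G) : G :=
  gmul (gmul (gmul (ginv x) (ginv y)) x) y.

Inductive gen (G : group) (S : G -> Prop) : G -> Prop :=
  | gen_in : forall x, S x -> gen S x
  | gen_one : gen S gone
  | gen_mul : forall x y, gen S x -> gen S y -> gen S (gmul x y)
  | gen_inv : forall x, gen S x -> gen S (ginv x).

(* lcs G n is the (n+1)-st term of the lower central series: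
   lcs G 0 = gamma_1(G) = G, lcs G (n+1) = [G, lcs G n] = gamma_(n+2)(G). *)
Fixpoint lcs (G : group) (n : nat) {struct n} : G -> Prop :=
  match n with
  | 0 => fun _ => True
  | n'.+1 => @gen G (fun z : G => exists x y : G,
                       @lcs G n' y /\ z = @gcomm G x y)
  end.

Arguments lcs : clear implicits.

Definition gamma (G : group) (i : nat) : G -> Prop := lcs G i.-1.

Arguments gamma : clear implicits.

Definition residually_nilpotent (G : group) : Prop :=
  forall x : G, (forall i, 1 <= i -> gamma G i x) -> x = gone.

Definition is_hom (G H : group) (f : G -> H) : Prop :=
  forall x y, f (gmul x y) = gmul (f x) (f y).

Definition group_iso (G H : group) : Prop :=
  exists f : G -> H, is_hom f /\ bijective f.

(* G / N isomorphic to H / M (N, M normal subgroups), unfolded: a map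
   f : G -> H inducing a well-defined bijective homomorphism
   G/N -> H/M, x N |-> f(x) M. *)
Definition quot_iso (G H : group) (N : G -> Prop) (M : H -> Prop) : Prop :=
  exists f : G -> H,
    [/\ (forall x y, M (gmul (ginv (gmul (f x) (f y))) (f (gmul x y)))),
        (forall x y, N (gmul (ginv x) y) -> M (gmul (ginv (f x)) (f y))),
        (forall x y, M (gmul (ginv (f x)) (f y)) -> N (gmul (ginv x) y)) &
        (forall h : H, exists x : G, M (gmul (ginv (f x)) h))].

Definition rank_two (G : group) : Prop :=
  (exists a b : G, forall x, gen (fun z => z = a \/ z = b) x) /\
  ~ (exists a : G, forall x, gen (fun z => z = a) x).

(* F is the free product C_m * C_n, i.e. F = < a, b | a^m, b^n >,
   characterized by its universal property. *)
Definition is_free_prod_cyclic (F : group) (m n : nat) : Prop :=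
  exists a b : F,
    [/\ gpow a m = gone, gpow b n = gone &
        forall (H : group) (x y : H), gpow x m = gone -> gpow y n = gone ->
          exists f : F -> H,
            [/\ is_hom f, f a = x, f b = y &
                forall g : F -> H, is_hom g -> g a = x -> g b = y ->
                  forall z, g z = f z]].

(* Main.v *)
From mathcomp Require Import all_boot all_algebra all_fingroup all_solvable.
From mathcomp Require Import ring.
From Stdlib Require Import Classical ClassicalEpsilon.
From Stdlib Require Import FunctionalExtensionality PropExtensionality.
Require Import Defs.

(** Let [v(x, d)] be a word in the commutator subgroup.  In a group [G], the
    equation [d v(x, d) = b] has a unique solution modulo each term of the lower
    central series: changing [d] by an element of [gamma_i] changes [v(x, d)] by
    an element of [gamma_(i+1)], so the iteration [d := b v(x, d)^-1] stabilizes.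
    Writing [F = < a, b | a^m, b^n >] and [d_i] for the solution modulo
    [gamma_i(F)], the group generated by [a] and [(d_i)_i] in the inverse limit
    of the [F / gamma_i(F)] is residually nilpotent with the same lower central
    quotients as [F], and it satisfies [a^m = (d v(a, d))^n = 1].

    It differs from [F] for a good choice of [v]: take a finite nonabelian simple
    group [S] generated by two elements of order [p], and [v] such that
    [(y v(x, y))^n <> 1] whenever [x, y] generate [S]; then [S] is a quotient of
    [F] only.  Such a [v] is built one generating pair at a time, as kernels of
    epimorphisms onto [S] are prime.

    The second group is the direct product of [F] and [T], with [T] finite,
    perfect and generated by two elements of order [q], for an odd prime [q <> p];
    coprimality of orders makes it two-generated, and [T] lies in every term of
    the lower central series. *)

Set Implicit Arguments.
Unset Strict Implicit.
Unset Printing Implicit Defensive.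

(** * Consequences of the group axioms, homomorphisms and powers *)

Section GroupTheory.
Variable G : group.
Implicit Types x y z : G.

Lemma gmulK x y : gmul (ginv x) (gmul x y) = y.
Proof. by rewrite gmulA gmulV gmul1. Qed.

Lemma gmulI x y z : gmul x y = gmul x z -> y = z.
Proof. by move=> e; rewrite -(gmulK x y) e gmulK. Qed.

Lemma gmulV_r x : gmul x (ginv x) = gone.
Proof.
rewrite -(gmul1 (gmul x _)) -(gmulV (ginv x)) -!gmulA; congr (gmul _ _).
by rewrite gmulK.
Qed.

Lemma gmul1_r x : gmul x gone = x.
Proof. by rewrite -(gmulV x) gmulA gmulV_r gmul1. Qed.

Lemma gmulVK x y : gmul x (gmul (ginv x) y) = y.
Proof. by rewrite gmulA gmulV_r gmul1. Qed.

Lemma ginvK x : ginv (ginv x) = x.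
Proof. by apply: (@gmulI (ginv x)); rewrite gmulV_r gmulV. Qed.

Lemma ginvM x y : ginv (gmul x y) = gmul (ginv y) (ginv x).
Proof. by apply: (@gmulI (gmul x y)); rewrite gmulV_r -gmulA gmulVK gmulV_r. Qed.

Lemma ginv1 : ginv gone = gone :> G.
Proof. by rewrite -[LHS]gmul1 gmulV_r. Qed.

End GroupTheory.

Ltac group_simpl :=
  rewrite /gcomm ?(ginvM, ginvK, ginv1, gmul1, gmul1_r) -?gmulA;
  rewrite ?(gmulK, gmulVK, gmulV, gmulV_r, gmul1, gmul1_r).

Section Homs.
Variables (G H : group) (f : G -> H).
Hypothesis fM : is_hom f.

Lemma hom1 : f gone = gone.
Proof. by apply: (@gmulI H (f gone)); rewrite -fM !gmul1_r. Qed.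

Lemma homV x : f (ginv x) = ginv (f x).
Proof. by apply: (@gmulI H (f x)); rewrite -fM !gmulV_r hom1. Qed.

Lemma homR x y : f (gcomm x y) = gcomm (f x) (f y).
Proof. by rewrite /gcomm !fM !homV. Qed.

Lemma homX x n : f (gpow x n) = gpow (f x) n.
Proof. by elim: n => [|n IHn] /=; rewrite ?hom1 ?fM ?IHn. Qed.

End Homs.

Lemma gpowD (G : group) (x : G) m n :
  gpow x (m + n) = gmul (gpow x m) (gpow x n).
Proof. by elim: m => [|m IHm] /=; rewrite ?gmul1 // IHm gmulA. Qed.

Lemma gpow1n (G : group) n : gpow gone n = gone :> G.
Proof. by elim: n => //= n ->; rewrite gmul1. Qed.

Lemma gpowM (G : group) (x : G) m n : gpow x (m * n) = gpow (gpow x m) n.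
Proof.
elim: n => [|n IHn]; first by rewrite muln0.
by rewrite mulnS gpowD IHn.
Qed.

Lemma gen_gpow (G : group) (S : G -> Prop) x n : gen S x -> gen S (gpow x n).
Proof. by move=> Sx; elim: n => [|n IHn] /=; [exact: gen_one | exact: gen_mul]. Qed.

(** * The lower central series and congruences modulo its terms *)

Section LowerCentral.
Variable G : group.
Implicit Types x y z : G.

Lemma lcs_one n : lcs G n gone.
Proof. by case: n => //= n; apply: gen_one. Qed.

Lemma lcs_mul n x y : lcs G n x -> lcs G n y -> lcs G n (gmul x y).
Proof. by case: n => //= n; apply: gen_mul. Qed.

Lemma lcs_inv n x : lcs G n x -> lcs G n (ginv x).
Proof. by case: n => //= n; apply: gen_inv. Qed.

Lemma lcs_commr n x y : lcs G n y -> lcs G n.+1 (gcomm x y).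
Proof. by move=> ny; apply: gen_in; exists x, y. Qed.

Lemma lcs_comml n x y : lcs G n x -> lcs G n.+1 (gcomm x y).
Proof.
move=> nx; have -> : gcomm x y = ginv (gcomm y x) by group_simpl.
by apply/lcs_inv/lcs_commr.
Qed.

Lemma lcs_succ n x : lcs G n.+1 x -> lcs G n x.
Proof.
elim: n x => // n IHn x; elim=> {x}.
- by move=> _ [x [y [ny ->]]]; apply/lcs_commr/IHn.
- exact: lcs_one.
- by move=> x y _ nx _; apply: lcs_mul.
- by move=> x _; apply: lcs_inv.
Qed.

Lemma lcs_conj n x y : lcs G n x -> lcs G n (gmul (ginv y) (gmul x y)).
Proof.
move=> nx; have -> : gmul (ginv y) (gmul x y) = gmul x (gcomm x y) by group_simpl.
by apply: lcs_mul => //; apply/lcs_succ/lcs_comml.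
Qed.

(** Congruence modulo $\gamma_{n+1}(G)$, following the index shift of [lcs]; level 0 is no
    condition. *)
Definition eqm n x y := lcs G n (gmul (ginv x) y).

Lemma eqm_refl n x : eqm n x x.
Proof. by rewrite /eqm gmulV; apply: lcs_one. Qed.

Lemma eqm_sym n x y : eqm n x y -> eqm n y x.
Proof. by move/lcs_inv; rewrite ginvM ginvK. Qed.

Lemma eqm_trans n x y z : eqm n x y -> eqm n y z -> eqm n x z.
Proof.
move=> xy yz; have := lcs_mul xy yz.
by rewrite -gmulA gmulVK.
Qed.

Lemma eqm_mul n x x' y y' :
  eqm n x x' -> eqm n y y' -> eqm n (gmul x y) (gmul x' y').
Proof.
move=> xx yy; have := lcs_mul (lcs_conj y xx) yy.
by rewrite /eqm; group_simpl.
Qed.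

Lemma eqm_inv n x y : eqm n x y -> eqm n (ginv x) (ginv y).
Proof.
move/eqm_sym=> xy; have := lcs_conj (ginv x) xy.
by rewrite /eqm; group_simpl.
Qed.

Lemma eqm1 n x : eqm n gone x <-> lcs G n x.
Proof. by rewrite /eqm ginv1 gmul1. Qed.

Lemma eqm_succ n x y : eqm n.+1 x y -> eqm n x y.
Proof. exact: lcs_succ. Qed.

Lemma eqm_lcs n x y : eqm n x y -> lcs G n x -> lcs G n y.
Proof. by move=> xy /eqm1 nx; apply/eqm1/(eqm_trans nx xy). Qed.

Lemma eqm_le m n x y : m <= n -> eqm n x y -> eqm m x y.
Proof.
move/subnKC <-; elim: (n - m) => [|j IHj]; rewrite ?addn0 // addnS.
by move/eqm_succ.
Qed.

Lemma eqm_pow n x y e : eqm n x y -> eqm n (gpow x e) (gpow y e).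
Proof.
by move=> xy; elim: e => [|e IHe] /=; [exact: eqm_refl | exact: eqm_mul].
Qed.

(* The quotient of consecutive terms of the lower central series is central,
   so commutators gain one degree of precision. *)
Lemma eqm_comm n x x' y y' :
  eqm n x x' -> eqm n y y' -> eqm n.+1 (gcomm x y) (gcomm x' y').
Proof.
move=> xx yy; apply: (@eqm_trans _ _ (gcomm x' y)).
  have := lcs_mul (lcs_commr (gcomm x y) xx) (lcs_comml y xx).
  by rewrite /eqm; group_simpl.
have := lcs_mul (lcs_conj (gcomm x' y) (lcs_commr x' yy))
  (lcs_commr (gcomm x' y) yy).
by rewrite /eqm; group_simpl.
Qed.

End LowerCentral.

Lemma hom_lcs (G H : group) (f : G -> H) n x :
  is_hom f -> lcs G n x -> lcs H n (f x).
Proof.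
move=> fM; elim: n x => // n IHn x; elim=> {x}.
- by move=> _ [x [y [ny ->]]]; rewrite homR //; apply/lcs_commr/IHn.
- by rewrite hom1 //; apply: lcs_one.
- by move=> x y _ fx _ fy; rewrite fM; apply: lcs_mul.
- by move=> x _ fx; rewrite homV //; apply: lcs_inv.
Qed.

Lemma hom_eqm (G H : group) (f : G -> H) n x y :
  is_hom f -> eqm n x y -> eqm n (f x) (f y).
Proof. by move=> fM /(hom_lcs fM); rewrite fM homV. Qed.

(** A homomorphism only modulo $\gamma_{n+1}(H)$. That it respects congruences on the source is a
    consequence, [qhom_eqm]. *)
Definition qhom (G H : group) n (f : G -> H) :=
  forall x y, eqm n (f (gmul x y)) (gmul (f x) (f y)).

Section Qhom.
Variables (G H : group) (n : nat) (f : G -> H).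
Hypothesis fM : qhom n f.

Lemma eqm_cancel x y z : eqm n (gmul x y) (gmul x z) -> @eqm H n y z.
Proof.
move=> e; have := eqm_mul (eqm_refl n (ginv x)) e.
by rewrite !gmulK.
Qed.

Lemma qhom1 : eqm n (f gone) gone.
Proof.
apply: (@eqm_cancel (f gone)); rewrite gmul1_r; apply: eqm_sym.
by have := fM gone gone; rewrite gmul1.
Qed.

Lemma qhomV x : eqm n (f (ginv x)) (ginv (f x)).
Proof.
apply: (@eqm_cancel (f x)); rewrite gmulV_r.
apply: eqm_trans (eqm_sym (fM _ _)) _; rewrite gmulV_r; exact: qhom1.
Qed.

Lemma qhom_comm x y : eqm n (f (gcomm x y)) (gcomm (f x) (f y)).
Proof.
rewrite /gcomm; do 2![apply: eqm_trans (fM _ _) _; apply: eqm_mul; last exact: eqm_refl].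
by apply: eqm_trans (fM _ _) _; apply: eqm_mul; apply: qhomV.
Qed.

(** Commutators map to commutators up to an error in [lcs H n], which the term of index [j] absorbs
    because [j <= n]. *)
Lemma qhom_lcs j x : j <= n -> lcs G j x -> lcs H j (f x).
Proof.
elim: j x => // j IHj x ltjn.
have le u v : @eqm H n u v -> eqm j.+1 u v by apply: eqm_le.
elim=> {x}.
- move=> _ [x [y [jy ->]]]; apply: eqm_lcs (le _ _ (eqm_sym (qhom_comm x y))) _.
  by apply/lcs_commr/IHj => //; apply: ltnW.
- by apply/eqm1/eqm_sym/le/qhom1.
- move=> x y _ fx _ fy; apply: eqm_lcs (le _ _ (eqm_sym (fM x y))) _.
  exact: lcs_mul.
- move=> x _ fx; apply: eqm_lcs (le _ _ (eqm_sym (qhomV x))) _; exact: lcs_inv.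
Qed.

Lemma qhom_eqm j x y : j <= n -> eqm j x y -> eqm j (f x) (f y).
Proof.
move=> lejn /(qhom_lcs lejn); apply: eqm_lcs.
apply: (@eqm_le _ _ n) => //; apply: eqm_trans (fM _ _) _.
by apply: eqm_mul; [exact: qhomV | exact: eqm_refl].
Qed.
End Qhom.

(** * Group words in two letters *)

Inductive word := WA | WD | W1 | WM of word & word | WI of word.

Definition WR u v := WM (WM (WM (WI u) (WI v)) u) v.
Definition WX u n := iter n (WM u) W1.

Fixpoint ev (G : group) (x y : G) (w : word) : G :=
  match w with
  | WA => x | WD => y | W1 => gone
  | WM u v => gmul (ev x y u) (ev x y v)
  | WI u => ginv (ev x y u)
  end.

(** A syntactic notion, so that one and the same word can be evaluated in [F] and in a finite simple
    group. *)
Inductive cword : word -> Prop :=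
  | cword_comm u v : cword (WR u v)
  | cword_one : cword W1
  | cword_mul u v : cword u -> cword v -> cword (WM u v)
  | cword_inv u : cword u -> cword (WI u).

Lemma ev_hom (G H : group) (f : G -> H) x y w :
  is_hom f -> f (ev x y w) = ev (f x) (f y) w.
Proof.
move=> fM; elim: w => //= [|u IHu v IHv|u IHu]; first exact: hom1.
  by rewrite fM IHu IHv.
by rewrite homV // IHu.
Qed.

Lemma evX (G : group) (x y : G) u n : ev x y (WX u n) = gpow (ev x y u) n.
Proof. by elim: n => //= n ->. Qed.

Lemma word_gen (G : group) (x y : G) w : gen (fun t => t = x \/ t = y) (ev x y w).
Proof.
elim: w => /= [|||u IHu v IHv|u IHu].
- by apply: gen_in; left.
- by apply: gen_in; right.
- exact: gen_one.
- exact: gen_mul.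
- exact: gen_inv.
Qed.

Lemma qhom_ev (G H : group) n (f : G -> H) x y w :
  qhom n f -> eqm n (f (ev x y w)) (ev (f x) (f y) w).
Proof.
move=> fM; elim: w => //= [||||u IHu]; try exact: eqm_refl.
- exact: qhom1.
- move=> u IHu w IHw; apply: eqm_trans (fM _ _) _; exact: eqm_mul.
- apply: eqm_trans (qhomV fM _) _; exact: eqm_inv.
Qed.

(** * The equation $d\,v(x,d)=b$ modulo terms of the lower central series *)

Section Equation.
Variables (G : group).
Implicit Types x y d : G.

Lemma ev_eqm n x x' y y' w :
  eqm n x x' -> eqm n y y' -> eqm n (ev x y w) (ev x' y' w).
Proof.
move=> xx yy; elim: w => //= [|u IHu v IHv|u IHu]; first exact: eqm_refl.
  exact: eqm_mul.
exact: eqm_inv.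
Qed.

(** Each commutator gains one degree of precision by [eqm_comm]; products and inverses keep it. *)
Lemma cword_eqm n x y y' v :
  cword v -> eqm n y y' -> eqm n.+1 (ev x y v) (ev x y' v).
Proof.
move=> cv yy; elim: cv => {v} [u v||u v _ IHu _ IHv|u _ IHu] /=.
- by apply: eqm_comm; apply: ev_eqm (eqm_refl _ _) yy.
- exact: eqm_refl.
- exact: eqm_mul.
- exact: eqm_inv.
Qed.

Variables (v : word) (cv : cword v).

(** If [d] and [d'] agree at level [j], the factors given by [v] agree at level [j.+1]; cancelling
    them from the equation makes [d] and [d'] agree there. *)
Lemma equation_uniq n x d d' :
  eqm n (gmul d (ev x d v)) (gmul d' (ev x d' v)) -> eqm n d d'.
Proof.
move=> e; suff: forall j, j <= n -> eqm j d d' by apply.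
elim=> // j IHj ltjn; have dd := IHj (ltnW ltjn).
have := eqm_mul (eqm_le ltjn e) (eqm_inv (cword_eqm x cv dd)).
by rewrite -!gmulA !gmulV_r !gmul1_r.
Qed.

Fixpoint equation_sol x b n : G :=
  if n is n'.+1 then gmul b (ginv (ev x (equation_sol x b n') v)) else b.

(** Consecutive iterates agree at level [n], and replacing the outer [d] by the next iterate cancels
    the factor given by [v] exactly. *)
Lemma equation_solP n x b :
  eqm n (gmul (equation_sol x b n) (ev x (equation_sol x b n) v)) b.
Proof.
have step j : eqm j (equation_sol x b j) (equation_sol x b j.+1).
  elim: j => // j IHj; apply: eqm_mul (eqm_refl _ _) _.
  exact/eqm_inv/cword_eqm.
apply: eqm_trans (eqm_mul (step n) (eqm_refl _ _)) _ => /=.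
by rewrite -gmulA gmulV gmul1_r; apply: eqm_refl.
Qed.
End Equation.

(** * Quotient groups of the set of words *)

Record word_congruence (R : word -> word -> Prop) : Prop := WordCongruence {
  wc_refl : forall u, R u u;
  wc_sym : forall u v, R u v -> R v u;
  wc_trans : forall u v w, R u v -> R v w -> R u w;
  wc_mul : forall u u' v v', R u u' -> R v v' -> R (WM u v) (WM u' v');
  wc_inv : forall u u', R u u' -> R (WI u) (WI u');
  wc_mulA : forall u v w, R (WM u (WM v w)) (WM (WM u v) w);
  wc_mul1 : forall u, R (WM W1 u) u;
  wc_mulV : forall u, R (WM (WI u) u) W1
}.

Section WordQuotient.
Variables (R : word -> word -> Prop) (Rc : word_congruence R).
Let Rrefl := wc_refl Rc.
Let Rsym := wc_sym Rc.
Let Rtrans := wc_trans Rc.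
Let RM := wc_mul Rc.
Let RI := wc_inv Rc.

(** A chosen representative of each class: the quotient becomes the subtype of fixed points of
    [wrep], whose equality is Leibniz equality, as [group] demands. *)
Definition wrep (u : word) : word := epsilon (inhabits W1) (R u).

Lemma wrepP u : R u (wrep u).
Proof. by apply: (epsilon_spec (inhabits W1)); exists u. Qed.

Lemma wrep_eq u v : R u v -> wrep u = wrep v.
Proof.
move=> uv; congr (epsilon _ _); apply: functional_extensionality => w.
apply: propositional_extensionality.
by split; [apply: Rtrans (Rsym uv) | apply: Rtrans uv].
Qed.

Lemma wrepK u : wrep (wrep u) = wrep u.
Proof. exact/wrep_eq/Rsym/wrepP. Qed.

Definition wclass := {u : word | wrep u = u}.
Definition wpi (u : word) : wclass := exist _ (wrep u) (wrepK u).

Lemma wpiP u v : wpi u = wpi v <-> R u v.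
Proof.
split=> [[e]|uv].
  by apply: Rtrans (wrepP u) _; rewrite e; apply/Rsym/wrepP.
by apply: eq_exist_uncurried; exists (wrep_eq uv); apply: proof_irrelevance.
Qed.

Lemma wpi_val (x : wclass) : wpi (sval x) = x.
Proof.
case: x => u e /=; apply: eq_exist_uncurried; exists e; exact: proof_irrelevance.
Qed.

Let wmul (x y : wclass) := wpi (WM (sval x) (sval y)).
Let winv (x : wclass) := wpi (WI (sval x)).

Let wmulA x y z : wmul x (wmul y z) = wmul (wmul x y) z.
Proof.
apply/wpiP; apply: Rtrans (RM (Rrefl _) (Rsym (wrepP _))) _.
by apply: Rtrans (wc_mulA Rc _ _ _) _; apply: RM (wrepP _) (Rrefl _).
Qed.

Let wmul1 x : wmul (wpi W1) x = x.
Proof.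
rewrite -[RHS]wpi_val; apply/wpiP.
apply: Rtrans (RM (Rsym (wrepP _)) (Rrefl _)) _; exact: wc_mul1.
Qed.

Let wmulV x : wmul (winv x) x = wpi W1.
Proof.
apply/wpiP; apply: Rtrans (RM (Rsym (wrepP _)) (Rrefl _)) _; exact: wc_mulV.
Qed.

Definition wgroup : group := Group wmulA wmul1 wmulV.

Lemma wpi_ev u : wpi u = ev (wpi WA : wgroup) (wpi WD) u.
Proof.
elim: u => //= [u IHu v IHv|u IHu].
  by rewrite -IHu -IHv; apply/wpiP; apply: RM; apply: wrepP.
by rewrite -IHu; apply/wpiP; apply: RI; apply: wrepP.
Qed.
End WordQuotient.

Arguments wpi {R} Rc u.

(** * Free products of two cyclic groups *)

Section FreeProduct.
Variables (F : group) (m n : nat) (a b : F).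
Hypothesis am : gpow a m = gone.
Hypothesis bn : gpow b n = gone.
Hypothesis univ : forall (H : group) (x y : H),
  gpow x m = gone -> gpow y n = gone ->
  exists f : F -> H, [/\ is_hom f, f a = x, f b = y &
    forall g : F -> H, is_hom g -> g a = x -> g b = y -> forall z, g z = f z].

Lemma free_prod_lift (H : group) (x y : H) :
  gpow x m = gone -> gpow y n = gone ->
  exists f : F -> H, [/\ is_hom f, f a = x & f b = y].
Proof. by move=> xm yn; have [f [? ? ? _]] := univ xm yn; exists f. Qed.

Lemma free_prod_ext (H : group) (f g : F -> H) :
  is_hom f -> is_hom g -> f a = g a -> f b = g b -> forall z, f z = g z.
Proof.
move=> fM gM fga fgb z.
have fam : gpow (f a) m = gone by rewrite -homX // am hom1.
have fbn : gpow (f b) n = gone by rewrite -homX // bn hom1.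
have [h [_ _ _ hu]] := univ fam fbn.
by rewrite (hu f) // (hu g).
Qed.

(** [K] is the subgroup generated by [a] and [b], encoded as words modulo equal value. The universal
    property maps [F] to [K], and following this by the evaluation [j] fixes [a] and [b], hence is
    the identity. *)
Lemma free_prod_word z : exists w, z = ev a b w.
Proof.
pose R u v := ev a b u = ev a b v.
have Rc : word_congruence R.
  rewrite /R; split=> //=.
  - by move=> u v w -> ->.
  - by move=> u u' v v' -> ->.
  - by move=> u u' ->.
  - by move=> u v w; rewrite gmulA.
  - by move=> u; rewrite gmul1.
  - by move=> u; rewrite gmulV.
pose K := wgroup Rc.
have [||f [fM fa fb]] := @free_prod_lift K (wpi Rc WA) (wpi Rc WD).
- rewrite -(evX (wpi Rc WA : K) (wpi Rc WD) WA) -wpi_ev; apply/wpiP.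
  by rewrite /R evX.
- rewrite -(evX (wpi Rc WA : K) (wpi Rc WD) WD) -wpi_ev; apply/wpiP.
  by rewrite /R evX.
pose j (x : K) : F := ev a b (sval x).
have jpi u : j (wpi Rc u) = ev a b u by symmetry; apply: (wrepP Rc).
have jM : is_hom j by move=> x y; rewrite {1}/gmul /= jpi.
exists (sval (f z)).
rewrite -[LHS]/((fun t => t) z) -[RHS]/((fun t => j (f t)) z).
apply: free_prod_ext => //=.
- by move=> x y; rewrite fM jM.
- by rewrite fa jpi.
- by rewrite fb jpi.
Qed.

End FreeProduct.

(** * The residually nilpotent group with the lower central quotients of [F] *)

Section Parafree.
Variables (F : group) (m n : nat) (a b : F).
Hypothesis am : gpow a m = gone.
Hypothesis bn : gpow b n = gone.
Hypothesis univ : forall (H : group) (x y : H),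
  gpow x m = gone -> gpow y n = gone ->
  exists f : F -> H, [/\ is_hom f, f a = x, f b = y &
    forall g : F -> H, is_hom g -> g a = x -> g b = y -> forall z, g z = f z].
Variables (v : word) (cv : cword v).

Let d i := equation_sol v a b i.
(** Words are identified when they agree at every level [i], with [WD] read as the approximate
    solution [d i]. The quotient by [R] is the subgroup of the inverse limit generated by [a] and
    $(d_i)_i$. *)
Let R u u' := forall i, eqm i (ev a (d i) u) (ev a (d i) u').

Lemma parafree_congruence : word_congruence R.
Proof.
rewrite /R; split=> /=.
- by move=> *; apply: eqm_refl.
- by move=> u w e i; apply/eqm_sym/e.
- by move=> u w t e e' i; apply: eqm_trans (e i) (e' i).
- by move=> u u' w w' e e' i; apply: eqm_mul.
- by move=> u u' e i; apply: eqm_inv.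
- by move=> u w t i; rewrite gmulA; apply: eqm_refl.
- by move=> u i; rewrite gmul1; apply: eqm_refl.
- by move=> u i; rewrite gmulV; apply: eqm_refl.
Qed.

Definition parafree : group := wgroup parafree_congruence.
Let A : parafree := wpi parafree_congruence WA.
Let D : parafree := wpi parafree_congruence WD.
(** Projection to level [i]. It evaluates a chosen representative, so it is a homomorphism only
    modulo $\gamma_{i+1}(F)$. *)
Let f i (h : parafree) : F := ev a (d i) (sval h).

Lemma parafree_word h : exists w, h = ev A D w.
Proof. by exists (sval h); rewrite -wpi_ev (wpi_val parafree_congruence). Qed.

Lemma parafree_proj_ev i u : eqm i (f i (ev A D u)) (ev a (d i) u).
Proof. by rewrite -wpi_ev; apply: eqm_sym; apply: (wrepP parafree_congruence). Qed.

Lemma parafree_proj_qhom i : qhom i (f i).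
Proof.
by move=> x y; apply: eqm_sym; apply: (wrepP parafree_congruence (WM (sval x) (sval y))).
Qed.

Lemma parafree_A : gpow A m = gone.
Proof.
rewrite -(evX A D WA) -wpi_ev; apply/wpiP=> i.
by rewrite evX /= am; apply: eqm_refl.
Qed.

Lemma parafree_B : gpow (gmul D (ev A D v)) n = gone.
Proof.
rewrite -[gmul D _]/(ev A D (WM WD v)) -evX -wpi_ev; apply/wpiP=> i.
rewrite evX /= -[X in eqm _ _ X]bn; apply: eqm_pow; exact: equation_solP.
Qed.

(** An element of every term projects into $\gamma_{i+1}(F)$ at each level [i], so its word is
    [R]-equivalent to [W1]. *)
Lemma parafree_residually_nilpotent : residually_nilpotent parafree.
Proof.
move=> h hn; rewrite -[h](wpi_val parafree_congruence).
apply: (proj2 (wpiP parafree_congruence _ W1)) => i.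
apply/eqm_sym/eqm1.
by apply: (qhom_lcs (@parafree_proj_qhom i)) => //; apply: (hn i.+1).
Qed.

(** The relations on [A] and [D] let [F] map to [parafree]. At level [i], both [g (d i)] and [D]
    solve the same equation, so they agree by uniqueness. *)
Lemma parafree_section : exists g : F -> parafree,
  [/\ is_hom g, g a = A, g b = gmul D (ev A D v) &
      forall i h, eqm i (g (f i h)) h].
Proof.
have [g [gM ga gb]] := free_prod_lift univ parafree_A parafree_B.
exists g; split=> // i h.
have gd : eqm i (g (d i)) D.
  apply: (equation_uniq cv (x := A)); rewrite -gb -ga -ev_hom // -gM.
  by apply: hom_eqm => //; apply: equation_solP.
rewrite /f ev_hom // ga -[X in eqm _ _ X](wpi_val parafree_congruence) wpi_ev.
exact: ev_eqm (eqm_refl _ _) gd.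
Qed.

(** The projection and the map [g] of [parafree_section] are mutually inverse modulo the given
    term. *)
Lemma parafree_quot i : 0 < i -> quot_iso (gamma parafree i) (gamma F i).
Proof.
case: i => // i _; have [g [gM ga gb gf]] := parafree_section.
have fM := @parafree_proj_qhom i.
exists (f i); split=> [x y|x y xy|x y fxy|z].
- exact/eqm_sym/fM.
- exact: (qhom_eqm fM).
- apply: (@eqm_trans _ i _ (g (f i x))); first exact/eqm_sym/gf.
  by apply: eqm_trans (gf i y); apply: hom_eqm.
- exists (g z); have [w ->] := free_prod_word am bn univ z.
  rewrite (ev_hom _ _ _ gM) ga gb; apply: eqm_trans (qhom_ev _ _ _ fM) _.
  apply: ev_eqm; first exact: (parafree_proj_ev i WA).
  apply: eqm_trans (parafree_proj_ev i (WM WD v)) _; exact: equation_solP.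
Qed.

Lemma exists_parafree : exists (G : group) (x y : G),
  [/\ forall h, exists w, h = ev x y w, gpow (gmul y (ev x y v)) n = gone,
      residually_nilpotent G &
      forall i, 0 < i -> quot_iso (gamma G i) (gamma F i)].
Proof.
exists parafree, A, D; split; [exact: parafree_word | exact: parafree_B |
  exact: parafree_residually_nilpotent | exact: parafree_quot].
Qed.
End Parafree.

(** * Abelian quotients and the lower bound on the rank *)

Section Additive.
Import GRing.Theory.
Local Open Scope ring_scope.

Definition zmod_group (V : zmodType) : group :=
  @Group V +%R -%R 0 (@addrA V) (@add0r V) (@addNr V).

Lemma zmod_group_lcs1 (V : zmodType) (x : zmod_group V) : lcs _ 1 x -> x = 0.
Proof.
elim=> {x} [_ [x [y [_ ->]]]||x y _ -> _ ->|x _ ->] //=.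
- by rewrite /gcomm /gmul /ginv /= -addrA -opprD addNr.
- by rewrite /gmul /= addr0.
- by rewrite /ginv /= oppr0.
Qed.

Lemma zmod_group_pow (V : zmodType) (x : zmod_group V) n : gpow x n = (x : V) *+ n.
Proof. by elim: n => //= n ->; rewrite mulrS. Qed.

(* The homomorphism to (Z/p)^2 separates the two generators modulo p. *)
Lemma quot_iso_not_cyclic (p m n : nat) (F G : group) :
  is_free_prod_cyclic F m n -> prime p -> (p %| m)%N -> (p %| n)%N ->
  quot_iso (gamma G 2) (gamma F 2) ->
  ~ exists c : G, forall x, gen (fun z => z = c) x.
Proof.
move=> [a [b [_ _ univ]]] p_pr pm pn [f [fM fN _ f_onto]] [c cgen].
pose V := ('F_p * 'F_p)%type; pose E := zmod_group V.
have kill (x : V) i : (p %| i)%N -> x *+ i = 0.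
  case/dvdnP=> j ->; rewrite mulnC mulrnA.
  have -> : x *+ p = 0.
    have z (y : 'F_p) : y *+ p = 0 by rewrite -mulr_natl pchar_Fp_0 ?mul0r.
    by rewrite [LHS]surjective_pairing !raddfMn !z.
  by rewrite mul0rn.
have [||th [thM tha thb _]] := univ E (1, 0) (0, 1).
- by rewrite zmod_group_pow kill.
- by rewrite zmod_group_pow kill.
(* The target is abelian, so [th] factors through $F/\gamma_2(F)$. *)
have th_eqm x y : eqm 1 x y -> th x = th y.
  move/(hom_eqm thM)/zmod_group_lcs1.
  by move/(canRL (gmulVK _)); rewrite gmul1_r.
pose ps x : V := th (f x).
have psM x y : ps (gmul x y) = ps x + ps y.
  by rewrite /ps -(th_eqm (gmul (f x) (f y))) ?thM //; apply: fM.
have ps1 : ps gone = 0 by apply: (addrI (ps gone)); rewrite -psM gmul1 addr0.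
have psV x : ps (ginv x) = - ps x.
  by apply: (addrI (ps x)); rewrite -psM gmulV_r ps1 subrr.
(* The image of a cyclic [G] lies on the line spanned by [ps c], which cannot contain both [(1, 0)]
   and [(0, 1)]. *)
have mult x : exists r : 'F_p, ps x = (r * (ps c).1, r * (ps c).2).
  elim: (cgen x) => {x} [_ ->||x y _ [r er] _ [s es]|x _ [r er]].
  - by exists 1; rewrite !mul1r; case: (ps c).
  - by exists 0; rewrite !mul0r ps1.
  - by exists (r + s); rewrite psM er es !mulrDl.
  - by exists (- r); rewrite psV er !mulNr.
have [x /th_eqm] := f_onto a; rewrite tha => ex.
have [y /th_eqm] := f_onto b; rewrite thb => ey.
have [r er] := mult x; have [s es] := mult y; rewrite /ps ex in er; rewrite /ps ey in es.
have er1 : 1 = r * (ps c).1 by move/(congr1 fst): er.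
have er2 : 0 = r * (ps c).2 by move/(congr1 snd): er.
have es2 : 1 = s * (ps c).2 by move/(congr1 snd): es.
have r0 : r = 0 by rewrite -[r]mulr1 {1}es2 mulrCA -er2 mulr0.
by apply/eqP: (oner_neq0 'F_p); rewrite er1 r0 mul0r.
Qed.
End Additive.

Definition fin_group (gT : finGroupType) : group :=
  @Group gT mulg invg 1%g (@mulgA gT) (@mul1g gT) (@mulVg gT).

Lemma fin_group_pow (gT : finGroupType) (x : fin_group gT) n :
  gpow x n = (x ^+ n)%g.
Proof. by elim: n => //= n ->; rewrite expgS. Qed.

(** * Finite simple quotients *)

Section SimpleQuotients.
Local Open Scope group_scope.
Variables (gT : finGroupType) (S : {group gT}).
Local Notation E := (@ev (fin_group gT)).
Implicit Types (x y t : gT) (u w : word).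

Lemma ev_mem x y w : x \in S -> y \in S -> E x y w \in S.
Proof.
move=> xS yS; elim: w => //= [u uS v vS|u uS]; first exact: groupM.
by rewrite groupV.
Qed.

Lemma ev_onto x y t : t \in <<[set x; y]>> -> exists w, E x y w = t.
Proof.
case/gen_prodgP=> n [c cA ->]; elim: n c cA => [|n IHn] c cA.
  by exists W1; rewrite big_ord0.
have [|w ew] := IHn (fun i => c (widen_ord (leqnSn n) i)); first by move=> i.
rewrite big_ord_recr /= -ew.
have := cA ord_max; rewrite !inE => /orP[] /eqP ->.
- by exists (WM w WA).
- by exists (WM w WD).
Qed.

Hypotheses (simS : simple S) (nabS : ~~ abelian S).

Let generates x y := <<[set x; y]>> == S.

Lemma generates_mem x y : generates x y -> x \in S /\ y \in S.
Proof. by move/eqP <-; split; apply: mem_gen; rewrite !inE eqxx ?orbT. Qed.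

Lemma simple_class_gen x : x \in S -> x != 1 -> <<x ^: S>> = S.
Proof.
move=> xS x1; have [_ sim] := simpleP _ simS.
have nor : <<x ^: S>> <| S.
  by rewrite /normal gen_subG class_subG //= norms_gen // class_norm.
case: (sim _ nor) => // e.
by case/negP: x1; rewrite -in_set1 -[[set 1]]e mem_gen // class_refl.
Qed.

(** By simplicity the conjugates of the value of [u] generate [S]. The word [w] is a product of
    conjugates of [u], hence vanishes in any group where [u] does. *)
Lemma normal_closure_word x y u t :
  generates x y -> E x y u != 1 -> t \in S ->
  exists w, E x y w = t /\
    forall (G : group) (x' y' : G), ev x' y' u = gone -> ev x' y' w = gone.
Proof.
move=> gxy u1; have [xS yS] := generates_mem gxy.
rewrite -{1}(simple_class_gen (ev_mem u xS yS) u1) => /gen_prodgP[n [c cA ->]].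
elim: n c cA => [|n IHn] c cA; first by exists W1; rewrite big_ord0.
have [|w [ew kw]] := IHn (fun i => c (widen_ord (leqnSn n) i)); first by move=> i.
rewrite big_ord_recr /= -ew.
have /imsetP[g gS ->] := cA ord_max.
move: gS; rewrite -{1}(eqP gxy) => /ev_onto[h <-].
exists (WM w (WM (WI h) (WM u h))); split=> //= G x' y' k.
by rewrite kw // k !gmul1 gmulV.
Qed.

Lemma simple_der1 : [~: S, S] = S.
Proof.
have [_ sim] := simpleP _ simS.
case: (sim _ (der_normal 1 S)) => // e.
by case/negP: nabS; apply/derG1P.
Qed.

(** As [S] is perfect, [t] is a product of commutators, whose entries are lifted by
    [normal_closure_word]. *)
Lemma normal_closure_cword x y u t :
  generates x y -> E x y u != 1 -> t \in S ->
  exists w, [/\ cword w, E x y w = t &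
    forall (G : group) (x' y' : G), ev x' y' u = gone -> ev x' y' w = gone].
Proof.
move=> gxy u1; rewrite -{1}simple_der1 => /gen_prodgP[n [c cA ->]].
elim: n c cA => [|n IHn] c cA.
  by exists W1; rewrite big_ord0; split=> //; apply: cword_one.
have [|w [cw ew kw]] := IHn (fun i => c (widen_ord (leqnSn n) i)); first by move=> i.
rewrite big_ord_recr /= -ew.
have /imset2P[g h gS hS ->] := cA ord_max.
have [wg [<- kg]] := normal_closure_word gxy u1 gS.
have [wh [<- kh]] := normal_closure_word gxy u1 hS.
exists (WM w (WR wg wh)); split=> //=.
- by apply: cword_mul => //; apply: cword_comm.
- by rewrite /gmul /ginv /= /commg /conjg !mulgA.
- by move=> G x' y' k /=; rewrite kw // kg // kh // ginv1 !gmul1.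
Qed.

(* Kernels of epimorphisms onto a nonabelian simple group are prime. *)
Lemma kernel_prime x y (s : seq (gT * gT)) :
  generates x y ->
  (forall u, (forall z, z \in s -> E z.1 z.2 u = 1) -> E x y u = 1) ->
  exists2 z, z \in s & forall u, E z.1 z.2 u = 1 -> E x y u = 1.
Proof.
move=> gxy; have [xS yS] := generates_mem gxy.
have wordS t : t \in S -> exists w, E x y w = t by rewrite -{1}(eqP gxy) => /ev_onto.
elim: s => [|z s IHs] ks.
  case/negP: nabS; suff -> : S :=: 1 by apply: abelian1.
  by apply/trivgP/subsetP=> t /wordS[w <-]; rewrite inE ks.
case: (classic (forall u, E z.1 z.2 u = 1 -> E x y u = 1)) => [kz|].
  by exists z => //; rewrite mem_head.
move=> /not_all_ex_not[u0 nk]; have [zu0 /eqP xu0] := imply_to_and _ _ nk.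
suff /IHs[z' z's kz'] : forall u, (forall z, z \in s -> E z.1 z.2 u = 1) ->
  E x y u = 1 by exists z' => //; rewrite inE z's orbT.
move=> u us; apply/eqP; apply: contraNT nabS => xu.
(* The commutator of [u] with a word in the normal closure of [u0] vanishes at [z] because of [u0]
   and on [s] because of [u], hence at [(x, y)]. So the value of [u] is central in [S], which has
   trivial center. *)
have cS t : t \in S -> commute (E x y u) t.
  move=> tS; have [w [<- kw]] := normal_closure_word gxy xu0 tS.
  have e : E x y (WR u w) = 1.
    apply/ks => z'; rewrite inE => /orP[/eqP ->|/us e] /=.
      by rewrite (kw (fin_group gT)) // /gmul /ginv /gone /= invg1 !mulg1 mulVg.
    by rewrite e /gmul /ginv /= invg1 mul1g mulg1 mulVg.
  by apply/commgP/eqP; rewrite -e /= /gmul /ginv /= /commg /conjg !mulgA.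
have Zu : E x y u \in 'Z(S).
  by rewrite inE ev_mem //; apply/centP.
have [_ sim] := simpleP _ simS; case: (sim _ (center_normal S)) => [Z1|ZS].
  by case/negP: xu; rewrite -in_set1 -[[set 1]]Z1.
by rewrite -ZS center_abelian.
Qed.

(** Induction on the list. Either the kernel of the new pair contains that of an earlier pair and
    the old [v] still works, or some [u] vanishes at all earlier pairs but not at the new one, and
    [v] is corrected inside the normal closure of [u]. *)
Lemma exists_cword_avoiding n (s : seq (gT * gT)) t :
  t \in S -> t ^+ n != 1 -> (forall z, z \in s -> generates z.1 z.2) ->
  exists2 v, cword v &
    forall z, z \in s -> (z.2 * E z.1 z.2 v) ^+ n != 1.
Proof.
move=> tS tn; elim: s => [|[x y] s IHs] gs; first by exists W1 => //; apply: cword_one.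
have gxy : generates x y by apply: (gs (x, y)); rewrite mem_head.
have [xS yS] := generates_mem gxy.
have [z zs|v cv vs] := IHs _; first by apply: gs; rewrite inE zs orbT.
case: (classic (forall u, (forall z, z \in s -> E z.1 z.2 u = 1) -> E x y u = 1)).
  move/(kernel_prime gxy)=> [z zs kz]; exists v => // _ /predU1P[->|/vs //] /=.
  apply/eqP=> e; case/negP: nabS.
  have gz : generates z.1 z.2 by apply: gs; rewrite inE zs orbT.
  have zn : E z.1 z.2 (WX (WM WD v) n) != 1 by rewrite evX fin_group_pow vs.
  have xn : E x y (WX (WM WD v) n) = 1 by rewrite evX fin_group_pow.
  (* Every [u] agrees at [z] with some [w] in the normal closure of $(d\,v)^n$. Both [w] and
     $w^{-1}u$ vanish at [(x, y)], so [u] does too, and [S] would be trivial. *)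
  suff -> : S :=: 1 by apply: abelian1.
  apply/trivgP/subsetP=> r; rewrite -{1}(eqP gxy) => /ev_onto[u <-]; rewrite inE.
  have [zS1 zS2] := generates_mem gz.
  have [w [ew kw]] := normal_closure_word gz zn (ev_mem u zS1 zS2).
  have /kz /= : E z.1 z.2 (WM (WI w) u) = 1 by rewrite /= ew /gmul /ginv /= mulVg.
  by rewrite (kw (fin_group gT)) // /gmul /ginv /gone /= invg1 mul1g => ->.
move=> /not_all_ex_not[u nk]; have [su /eqP xu] := imply_to_and _ _ nk.
(* The correction is chosen so that the value of $d\,v\,w$ at [(x, y)] is [t]. *)
have rS : (y * E x y v)^-1 * t \in S by rewrite groupM ?groupV ?groupM ?ev_mem.
have [w [cw ew kw]] := normal_closure_cword gxy xu rS.
exists (WM v w); first exact: cword_mul.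
move=> z /predU1P[->|zs] /=; first by rewrite ew /= mulgA mulKVg.
by rewrite (kw (fin_group gT)) ?su // /gmul /gone /= mulg1 vs.
Qed.

(** Otherwise [S] is a [p]-group, hence solvable, and a solvable simple group has prime order. *)
Lemma simple_not_pgroup p k : prime p -> exists2 t, t \in S & t ^+ (p ^ k) != 1.
Proof.
move=> p_pr; case: (pickP [pred t in S | t ^+ (p ^ k) != 1]) => [t /andP[]|none].
  by exists t.
case/negP: nabS; have pS : p.-group S.
  rewrite -pnat_exponent; apply: (@pnat_dvd _ (p ^ k)); last by rewrite pnatX pnat_id.
  by apply/exponentP=> t tS; have := none t; rewrite inE tS => /negbFE/eqP.
have := simple_sol_prime (pgroup_sol pS) simS.
by move/prime_cyclic/cyclic_abelian.
Qed.

Lemma exists_cword_no_quotient p k : prime p ->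
  exists2 v, cword v & forall x y : fin_group gT,
    generates x y -> gpow (gmul y (ev x y v)) (p ^ k) <> gone.
Proof.
move=> p_pr; have [t tS tn] := simple_not_pgroup k p_pr.
pose s := [seq z <- enum {: gT * gT} | generates z.1 z.2].
have [z|v cv vs] := @exists_cword_avoiding _ s t tS tn.
  by rewrite mem_filter => /andP[].
exists v => // x y gxy; rewrite fin_group_pow.
by apply/eqP/(vs (x, y)); rewrite mem_filter gxy mem_enum.
Qed.

End SimpleQuotients.

(** * Perfect groups generated by two elements of order p *)

Section PerfectGroups.
Local Open Scope group_scope.

(** The hypothesis on [g] says $[x,g]=x^i$, and [x] is a power of $x^i$ by coprimality, so [x] lies
    in the derived subgroup; likewise [y] with [h]. *)
Lemma perfect_conj_power (gT : finGroupType) (x y g h : gT) p i :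
  x ^+ p = 1 -> y ^+ p = 1 -> coprime p i ->
  g \in <<[set x; y]>> -> h \in <<[set x; y]>> ->
  x * g = g * x ^+ i.+1 -> y * h = h * y ^+ i.+1 ->
  [~: <<[set x; y]>>, <<[set x; y]>>] = <<[set x; y]>>.
Proof.
move=> xp yp co gG hG xg yh; set G := <<_>> in gG hG *.
have inG z k : z ^+ p = 1 -> z \in G -> k \in G -> z * k = k * z ^+ i.+1 ->
    z \in [~: G, G].
  move=> zp zG kG zk.
  have ci : coprime #[z] i by apply: coprime_dvdl co; rewrite order_dvdn zp.
  have : z ^+ i \in [~: G, G].
    have -> : z ^+ i = [~ z, k] by rewrite commgEl /conjg zk mulKg expgS mulKg.
    exact: mem_commg.
  rewrite -cycle_subG => sG; apply: (subsetP sG).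
  by have := generator_coprime z i; rewrite ci => /eqP <-; apply: cycle_id.
have [xG yG] : x \in G /\ y \in G by split; apply: mem_gen; rewrite !inE eqxx ?orbT.
apply/eqP; rewrite eqEsubset (der_sub 1 <<[set x; y]>>) /= gen_subG.
by apply/subsetP=> z; rewrite !inE => /orP[] /eqP ->; [apply: inG gG xg | apply: inG hG yh].
Qed.
End PerfectGroups.

Section SL2.
Import GRing.Theory.
Local Open Scope ring_scope.
Variable R : finFieldType.

Definition mx2 (a b c d : R) : 'M[R]_2 :=
  \matrix_(i, j) (if i == 0 then if j == 0 then a else b
                  else if j == 0 then c else d).

Lemma mx2M a b c d a' b' c' d' :
  mx2 a b c d * mx2 a' b' c' d' =
  mx2 (a * a' + b * c') (a * b' + b * d') (c * a' + d * c') (c * b' + d * d').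
Proof.
apply/matrixP=> i j; rewrite !mxE !big_ord_recl big_ord0 !mxE /= addr0.
by case: i => -[|[|]] //=; case: j => -[|[|]].
Qed.

Lemma mx2_1 : 1 = mx2 1 0 0 1.
Proof.
apply/matrixP=> i j; rewrite !mxE.
by case: i => -[|[|]] //= ?; case: j => -[|[|]].
Qed.

Lemma mx2_unit a b c d : a * d - b * c = 1 -> mx2 a b c d \is a GRing.unit.
Proof.
move=> e; apply/unitrP; exists (mx2 d (- b) (- c) a).
by rewrite !mx2M mx2_1; split; congr mx2; rewrite -?e; ring.
Qed.

Definition sl2 a b c d (e : a * d - b * c = 1) : {'GL_2[R]} :=
  FinRing.Unit (mx2_unit e).

Lemma mx2_upperX n : mx2 1 1 0 1 ^+ n = mx2 1 n%:R 0 1.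
Proof.
elim: n => [|n IHn]; first by rewrite expr0 mx2_1.
by rewrite exprS IHn mx2M; congr mx2; ring.
Qed.

Lemma mx2_lowerX n : mx2 1 0 1 1 ^+ n = mx2 1 0 n%:R 1.
Proof.
elim: n => [|n IHn]; first by rewrite expr0 mx2_1.
by rewrite exprS IHn mx2M; congr mx2; ring.
Qed.

End SL2.

Definition perfect_generation (p : nat) := exists (gT : finGroupType) (x y : gT),
  [/\ x ^+ p = 1, y ^+ p = 1, x != 1 &
      [~: <<[set x; y]>>, <<[set x; y]>>] = <<[set x; y]>>]%g.

Lemma mem_gen_pair (gT : finGroupType) (x y : gT) :
  let G := <<[set x; y]>>%g in x \in G /\ y \in G.
Proof. by split; apply: mem_gen; rewrite !inE eqxx ?orbT. Qed.

Lemma perfect_of_order3 (gT : finGroupType) (x y : gT) :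
  let g := (y * x * x * y * y * x * y)%g in
  let h := (x * y * x * x * y * y * x)%g in
  (x ^+ 3 = 1 -> y ^+ 3 = 1 -> x * g = g * x ^+ 2 -> y * h = h * y ^+ 2 ->
  [~: <<[set x; y]>>, <<[set x; y]>>] = <<[set x; y]>>)%g.
Proof.
move=> g h x3 y3 xg yh; have [xG yG] := mem_gen_pair x y.
by apply: (@perfect_conj_power _ x y g h 3 1) => //; rewrite !groupM.
Qed.

Section Generation.
Import GRing.Theory.
Local Open Scope ring_scope.

(* SL_2(F_3) is not perfect, so the case p = 3 uses two elements of order 3 in
   SL_2(F_5), each conjugate to its inverse; the conjugating words of
   [perfect_of_order3] come from a computer search. *)
Lemma perfect_generation_3 : perfect_generation 3.
Proof.
have ex : (0 * -1 - (-1) * 1 = 1 :> 'F_5)%R by apply/eqP.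
have ey : (0 * -1 - 1 * (-1) = 1 :> 'F_5)%R by apply/eqP.
exists {'GL_2['F_5]}, (sl2 ex), (sl2 ey); split.
- by apply/val_inj; rewrite /= !mx2M mx2_1; congr mx2; apply/eqP; vm_compute.
- by apply/val_inj; rewrite /= !mx2M mx2_1; congr mx2; apply/eqP; vm_compute.
- by apply/eqP=> /(congr1 val) /= /matrixP/(_ ord0 ord0); rewrite mx2_1 !mxE.
apply: perfect_of_order3; apply/val_inj.
- by rewrite /= !mx2M mx2_1; congr mx2; apply/eqP; vm_compute.
- by rewrite /= !mx2M mx2_1; congr mx2; apply/eqP; vm_compute.
- by rewrite /= !mx2M; congr mx2; apply/eqP; vm_compute.
- by rewrite /= !mx2M; congr mx2; apply/eqP; vm_compute.
Qed.

(** The case $i=3$, coprime to [p] since [p > 3]: [g] conjugates [x] to $x^4$ and its inverse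
    conjugates [y] to $y^4$. *)
Lemma perfect_of_torus (gT : finGroupType) (x y : gT) p i j k :
  let g := (x ^+ i * y ^+ j * x ^+ i * (x * y ^+ k * x))%g in
  (prime p -> 3 < p -> x ^+ p = 1 -> y ^+ p = 1 ->
  x * g = g * x ^+ 4 -> g * y = y ^+ 4 * g ->
  [~: <<[set x; y]>>, <<[set x; y]>>] = <<[set x; y]>>)%g%N.
Proof.
move=> g p_pr p3 xp yp xg yg; have [xG yG] := mem_gen_pair x y.
have gG : g \in <<[set x; y]>>%g by rewrite !groupM // groupX.
have co : coprime p 3.
  by rewrite prime_coprime // dvdn_prime2 //; apply: contraTneq p3 => ->.
apply: (@perfect_conj_power _ x y g g^-1 p 3) => //; first by rewrite groupV.
by apply: (mulgI g); rewrite mulgA yg mulgK mulKVg.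
Qed.

(** Elementary matrices have order [p], and conjugation by $\mathrm{diag}(-1/2,-2)$ multiplies the
    off-diagonal entry of [x] by 4. *)
Lemma perfect_generation_ge5 p : prime p -> (3 < p)%N -> perfect_generation p.
Proof.
move=> p_pr p3; pose R : finFieldType := 'F_p.
have ex : 1 * 1 - 1 * 0 = 1 :> R by ring.
have ey : 1 * 1 - 0 * 1 = 1 :> R by ring.
have p0 : p%:R = 0 :> R by apply: pchar_Fp_0.
pose x := sl2 ex; pose y := sl2 ey.
have xX n : val (x ^+ n)%g = mx2 (1 : R) n%:R 0 1.
  by rewrite FinRing.val_unitX -mx2_upperX.
have yX n : val (y ^+ n)%g = mx2 (1 : R) 0 n%:R 1.
  by rewrite FinRing.val_unitX -mx2_lowerX.
have xp : (x ^+ p)%g = 1%g by apply: val_inj; rewrite xX p0 /= mx2_1.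
have yp : (y ^+ p)%g = 1%g by apply: val_inj; rewrite yX p0 /= mx2_1.
exists {'GL_2[R]}, x, y; split=> //.
  apply/eqP=> /(congr1 val) /= /matrixP/(_ ord0 ord_max); rewrite mx2_1 !mxE /=.
  by apply/eqP; rewrite oner_eq0.
(* [s] is $1/2$ in $\mathbf F_p$; the exponents [p.-1] and [p.-2] stand for $-1$ and $-2$. *)
pose s : R := (p.+1./2)%:R.
have s2 : s * 2 = 1.
  have odd_p : odd p by case: (even_prime p_pr) p3 => [->|].
  rewrite -natrM muln2 halfK /= odd_p /= subn0 -natr1 p0; ring.
have p1 : p.-1%:R = -1 :> R.
  by apply: (addIr 1); rewrite natr1 prednK ?prime_gt0 // p0; ring.
have p2 : p.-2%:R = - 2 :> R.
  have e : (p.-2 + 2)%N = p by rewrite addn2; case: (p) p3 => [|[|n]].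
  by apply: (addIr 2); rewrite -natrD e p0; ring.
(* With [w(c) = x^c y^(-1/c) x^c], this is [w(1/2) w(1) = diag(-1/2, -2)]. *)
have gE : val (x ^+ p.+1./2 * y ^+ p.-2 * x ^+ p.+1./2 * (x * y ^+ p.-1 * x))%g
    = mx2 (- s) 0 0 (- 2).
  rewrite !FinRing.val_unitM !xX !yX /= p1 p2 -/s !mx2M.
  have -> : s * -2 = -1 by rewrite mulrN s2.
  by clearbody s; congr mx2; ring: s2.
have s4 : s * 4 = 2 by rewrite (_ : 4 = 2 * 2) ?mulrA ?s2 ?mul1r //; ring.
apply: (@perfect_of_torus _ x y p p.+1./2 p.-2 p.-1) => //.
- apply: val_inj; rewrite [LHS]FinRing.val_unitM [RHS]FinRing.val_unitM gE xX !mx2M.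
  by congr mx2; rewrite ?mulNr ?s4; ring.
- apply: val_inj; rewrite [LHS]FinRing.val_unitM [RHS]FinRing.val_unitM gE yX !mx2M.
  by congr mx2; rewrite ?mulrN ?(mulrC 4) ?s4; ring.
Qed.

End Generation.

Lemma odd_prime_perfect_generation p : prime p -> odd p -> perfect_generation p.
Proof.
move=> p_pr odd_p; case: (ltngtP p 3) => [lt3|gt3|->].
- by case: p p_pr odd_p lt3 => [|[|[|]]].
- exact: perfect_generation_ge5.
- exact: perfect_generation_3.
Qed.

(** The quotient of a nontrivial perfect group by a maximal normal subgroup is simple and perfect,
    hence nonabelian. *)
Lemma exists_simple_quotient p : prime p -> odd p ->
  exists (gT : finGroupType) (S : {group gT}) (x y : gT),
  [/\ (x ^+ p = 1)%g, (y ^+ p = 1)%g, <<[set x; y]>>%g = S, simple S & ~~ abelian S].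
Proof.
move=> p_pr odd_p.
have [gT [x [y [xp yp x1 perf]]]] := odd_prime_perfect_generation p_pr odd_p.
have [xG yG] := mem_gen_pair x y.
pose G := <<[set x; y]>>%G.
have ntG : G :!=: 1%g by apply: contraNneq x1 => G1; rewrite -in_set1 -[[set 1%g]]G1.
have [M maxM] := ex_maxnormal_ntrivg ntG.
have nsM := maxnormal_normal maxM; have nM := normal_norm nsM.
have sim : simple (G / M)%G by rewrite quotient_simple.
exists (coset_of M), (G / M)%G, (coset M x), (coset M y).
have [xN yN] := (subsetP nM _ xG, subsetP nM _ yG).
split=> //.
- by rewrite -morphX //= xp morph1.
- by rewrite -morphX //= yp morph1.
- rewrite /= /quotient morphim_gen ?subUset ?sub1set ?xN //.
  by rewrite morphimU !morphim_set1.
apply/negP=> /commG1P; rewrite -quotientR // perf => GM1.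
by have [/eqP] := simpleP _ sim.
Qed.

Lemma perfect_lcs (gT : finGroupType) :
  [~: [set: gT], [set: gT]]%g = [set: gT] ->
  forall j (t : fin_group gT), lcs _ j t.
Proof.
move=> perf; elim=> // j IHj t.
have : t \in [~: [set: gT], [set: gT]]%g by rewrite perf inE.
case/gen_prodgP=> n [c cA ->]; elim: n c cA => [|n IHn] c cA.
  by rewrite big_ord0; apply: lcs_one.
rewrite big_ord_recr; apply: (@lcs_mul (fin_group gT)).
  by apply: IHn => i; apply: cA.
have /imset2P[g h _ _ ->] := cA ord_max.
have := @lcs_commr (fin_group gT) j g h (IHj h).
by rewrite /gcomm /gmul /ginv /= /commg /conjg !mulgA.
Qed.

Lemma exists_perfect_group q : prime q -> odd q ->
  exists (gT : finGroupType) (s t : gT),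
  [/\ (s ^+ q = 1)%g, (t ^+ q = 1)%g, s != 1%g,
      forall z : gT, exists w, z = ev (s : fin_group gT) t w &
      forall j (z : fin_group gT), lcs _ j z].
Proof.
move=> q_pr odd_q.
have [gT [x [y [xq yq x1 perf]]]] := odd_prime_perfect_generation q_pr odd_q.
have [xG yG] := mem_gen_pair x y.
pose G := <<[set x; y]>>%G.
exists (subg_of G), (subg G x), (subg G y); split.
- by rewrite -morphX //= xq morph1.
- by rewrite -morphX //= yq morph1.
- by apply: contraNneq x1 => /(congr1 sgval); rewrite subgK //= => ->.
- move=> z; have : z \in (subg G @* G)%g by rewrite im_subg inE.
  rewrite morphim_gen ?subUset ?sub1set ?xG //.
  rewrite morphimU !morphim_set1 // => /ev_onto[w <-]; by exists w.
apply: perfect_lcs; have -> : [set: subg_of G] = (subg G @* G)%g by rewrite im_subg.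
by rewrite -morphimR //= perf.
Qed.

(** * Direct products with a perfect group *)

Definition prod_group (G H : group) : group.
Proof.
refine (@Group (G * H) (fun x y => (gmul x.1 y.1, gmul x.2 y.2))
  (fun x => (ginv x.1, ginv x.2)) (gone, gone) _ _ _).
- by move=> x y z; rewrite !gmulA.
- by move=> [x y]; rewrite !gmul1.
- by move=> x; rewrite !gmulV.
Defined.

Section Product.
Variables G H : group.
Local Notation P := (prod_group G H).

Lemma fst_hom : is_hom (fst : P -> G). Proof. by []. Qed.

Lemma inl_hom : is_hom (fun x : G => (x, gone) : P).
Proof. by move=> x y; rewrite /gmul /= gmul1. Qed.

Lemma inr_hom : is_hom (fun y : H => (gone, y) : P).
Proof. by move=> x y; rewrite /gmul /= gmul1. Qed.

Lemma prod_pow (x : G) (y : H) n : gpow ((x, y) : P) n = (gpow x n, gpow y n).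
Proof. by elim: n => //= n ->. Qed.

Lemma prod_split (x : G) (y : H) : ((x, y) : P) = gmul ((x, gone) : P) ((gone, y) : P).
Proof. by rewrite /gmul /= gmul1 gmul1_r. Qed.

Hypothesis H_perfect : forall j (y : H), lcs H j y.

(** The perfect factor lies in every term, so only the first coordinate matters. *)
Lemma prod_lcs n (z : P) : lcs P n z <-> lcs G n z.1.
Proof.
split=> [|xn]; first exact: hom_lcs fst_hom.
case: z xn => x y /= xn; rewrite prod_split; apply: lcs_mul.
  exact: (hom_lcs inl_hom).
exact: (hom_lcs inr_hom).
Qed.

Lemma quot_iso_prodl i : quot_iso (gamma P i) (gamma G i).
Proof.
exists fst; split=> [x y|x y|x y|h].
- by rewrite gmulV; apply: lcs_one.
- by move/prod_lcs.
- by move=> xy; apply/prod_lcs.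
- by exists (h, gone); rewrite gmulV; apply: lcs_one.
Qed.

Lemma quot_iso_prodr (K : group) i :
  quot_iso (gamma K i) (gamma G i) -> quot_iso (gamma K i) (gamma P i).
Proof.
case=> f [fM fN fI fS]; exists (fun x => (f x, gone)); split=> [x y|x y xy|x y|h].
- exact/prod_lcs/fM.
- exact/prod_lcs/fN.
- by move/prod_lcs=> /= /fI.
- by have [x fx] := fS h.1; exists x; apply/prod_lcs.
Qed.

Lemma prod_not_residually_nilpotent (y : H) : y <> gone -> ~ residually_nilpotent P.
Proof.
move=> y1 rn; have [] // : (gone, y) = gone :> P.
by apply: rn => i _; apply/prod_lcs; apply: lcs_one.
Qed.
End Product.

Lemma gpow_modn (G : group) (x : G) m e : gpow x m = gone -> gpow x e = gpow x (e %% m).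
Proof.
by move=> xm; rewrite {1}(divn_eq e m) gpowD mulnC gpowM xm gpow1n gmul1.
Qed.

Lemma ev_gen (G : group) (S : G -> Prop) x y w : gen S x -> gen S y -> gen S (ev x y w).
Proof.
move=> Sx Sy; elim: w => //= [|u IHu v IHv|u IHu].
- exact: gen_one.
- exact: gen_mul.
- exact: gen_inv.
Qed.

(** Chinese remainders give exponents that are 1 modulo one order and 0 modulo the other, so powers
    of [(a, s)] and [(b, t)] isolate each coordinate. *)
Lemma prod_coprime_gen (G H : group) (a b : G) (s t : H) m n q :
  (forall z, exists w, z = ev a b w) -> (forall z, exists w, z = ev s t w) ->
  gpow a m = gone -> gpow b n = gone -> gpow s q = gone -> gpow t q = gone ->
  1 < m -> 1 < n -> 1 < q -> coprime m q -> coprime n q ->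
  forall z : prod_group G H, @gen (prod_group G H) (fun u => u = (a, s) \/ u = (b, t)) z.
Proof.
move=> Gw Hw am bn sq tq m1 n1 q1 mq nq; set S := fun u : prod_group G H => _.
have split_gen (x : G) (y : H) e : 1 < e -> coprime e q -> gpow x e = gone ->
    gpow y q = gone -> gen S (x, y) -> gen S (x, gone) /\ gen S (gone, y).
  move=> e1 eq xe yq Sxy; split.
    suff <- : gpow ((x, y) : prod_group G H) (chinese e q 1 0) = (x, gone) by apply: gen_gpow.
    rewrite prod_pow (gpow_modn _ xe) (gpow_modn _ yq) chinese_modl // chinese_modr //.
    by rewrite mod0n modn_small //= gmul1_r.
  suff <- : gpow ((x, y) : prod_group G H) (chinese e q 0 1) = (gone, y) by apply: gen_gpow.
  rewrite prod_pow (gpow_modn _ xe) (gpow_modn _ yq) chinese_modl // chinese_modr //.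
  by rewrite mod0n modn_small //= gmul1_r.
have [Sa Ss] := split_gen _ _ _ m1 mq am sq (gen_in (or_introl erefl)).
have [Sb St] := split_gen _ _ _ n1 nq bn tq (gen_in (or_intror erefl)).
case=> x y; rewrite prod_split; apply: gen_mul.
  by have [w ->] := Gw x; rewrite (ev_hom _ _ _ (@inl_hom G H)); apply: ev_gen.
by have [w ->] := Hw y; rewrite (ev_hom _ _ _ (@inr_hom G H)); apply: ev_gen.
Qed.

(* Pigeonhole on the finite set Hom(F, T): an isomorphism [F x T -> F] gives a
   surjective endomorphism [e] of [F], composition with [e] permutes Hom(F, T),
   hence every homomorphism to [T] would kill the kernel of [e]. *)
Lemma free_prod_not_iso_prod (F : group) m n (gT : finGroupType) (t : gT) :
  is_free_prod_cyclic F m n -> t != 1%g ->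
  ~ group_iso (prod_group F (fin_group gT)) F.
Proof.
move=> [a [b [am bn univ]]] t1 [f [fM [f' fK f'K]]].
pose T := fin_group gT.
have f'M : is_hom f' by move=> x y; rewrite -{1}[x]f'K -{1}[y]f'K -fM fK.
pose e x := (f' x).1; pose r x : T := (f' x).2.
have eM : is_hom e by move=> x y; rewrite /e f'M.
have rM : is_hom r by move=> x y; rewrite /r f'M.
have e_onto x : exists y, e y = x by exists (f (x, gone)); rewrite /e fK.
(* [X] encodes Hom(F, T) by the images of [a] and [b]; below, [L] decodes and [Psi] is composition
   with [e]. *)
pose X := {z : gT * gT | (z.1 ^+ m == 1)%g && (z.2 ^+ n == 1)%g}.
have mkX (h : F -> T) : is_hom h -> exists z : X, val z = (h a, h b).
  move=> hM; suff zX : ((h a : gT) ^+ m == 1)%g && ((h b : gT) ^+ n == 1)%g.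
    by exists (exist _ (h a : gT, h b : gT) zX).
  by rewrite -!fin_group_pow -!homX // am bn hom1 // eqxx.
have lift (z : X) : exists h : F -> T, [/\ is_hom h, h a = (val z).1 & h b = (val z).2].
  case: z => -[x y] /= /andP[/eqP xm /eqP yn].
  by apply: (free_prod_lift univ (H := T)); rewrite fin_group_pow.
pose L z := proj1_sig (constructive_indefinite_description _ (lift z)).
have LP z : [/\ is_hom (L z), L z a = (val z).1 & L z b = (val z).2].
  by rewrite /L; case: constructive_indefinite_description.
have LM z : is_hom (L z) by have [] := LP z.
have LeM z : is_hom (L z \o e) by move=> x y /=; rewrite eM LM.
pose Psi z : X := proj1_sig (constructive_indefinite_description _ (mkX _ (LeM z))).
have PsiE z : val (Psi z) = (L z (e a), L z (e b)).
  by rewrite /Psi; case: constructive_indefinite_description.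
have Psi_inj : injective Psi.
  move=> z z' /(congr1 val); rewrite !PsiE => -[ea eb].
  have Le := free_prod_ext am bn univ (LeM z) (LeM z') ea eb.
  have LL x : L z x = L z' x by have [y <-] := e_onto x; apply: Le.
  apply: val_inj; have [_ za zb] := LP z; have [_ za' zb'] := LP z'.
  by rewrite [LHS]surjective_pairing [RHS]surjective_pairing -za -zb -za' -zb' !LL.
(* Surjectivity of [Psi] factors [r] through [e]; but [f (gone, t)] lies in the kernel of [e], while
   [r] sends it to [t]. *)
have [z ez] := mkX _ rM.
have [z' z'K] : exists z', Psi z' = z.
  by have [g _ gK] := injF_bij Psi_inj; exists (g z).
have [ra rb] : L z' (e a) = r a /\ L z' (e b) = r b.
  by move: (PsiE z'); rewrite z'K ez => -[-> ->].
have := free_prod_ext am bn univ (LeM z') rM ra rb (f (gone, t)).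
by rewrite /r /e /= fK /= hom1 // => /esym/eqP; rewrite (negPf t1).
Qed.

(** * Comparison of the two groups with [F] *)

Theorem mainTheorem16 (p l k : nat) :
  prime p -> odd p -> 0 < l -> 0 < k ->
  forall F : group, is_free_prod_cyclic F (p ^ l) (p ^ k) ->
  exists G1 G2 : group,
    rank_two G1 /\ rank_two G2 /\
    ~ group_iso G1 F /\ ~ group_iso G2 F /\
    (forall i, 1 <= i ->
       quot_iso (gamma G1 i) (gamma G2 i) /\
       quot_iso (gamma G2 i) (gamma F i)) /\
    residually_nilpotent G1 /\
    ~ residually_nilpotent G2.
Proof.
move=> p_pr odd_p l0 k0 F freeF; have [a [b [am bn univ]]] := freeF.
have not_cyclic (G : group) : quot_iso (gamma G 2) (gamma F 2) ->
    ~ exists c : G, forall x, gen (fun z => z = c) x.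
  by apply: quot_iso_not_cyclic freeF p_pr _ _; apply: dvdn_exp.
have pow_p (G : group) (x : G) j : 0 < j -> gpow x p = gone -> gpow x (p ^ j) = gone.
  by case: j => // j _ xp; rewrite expnS gpowM xp gpow1n.
have [gT [S [x [y [xp yp xyS simS nabS]]]]] := exists_simple_quotient p_pr odd_p.
have [v cv vS] := exists_cword_no_quotient simS nabS k p_pr.
have [G1 [A [D [G1w Bn rnG1 G1F]]]] := exists_parafree am bn univ cv.
(* An odd prime different from [p]. *)
pose q := if p == 3 then 5 else 3.
have [q_pr odd_q pq] : [/\ prime q, odd q & coprime p q].
  rewrite /q; case: eqP => [->|/eqP p3]; split=> //.
  by rewrite prime_coprime // dvdn_prime2.
have [tT [s [t [sq tq s1 Tw Tperf]]]] := exists_perfect_group q_pr odd_q.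
pose T := fin_group tT; pose G2 := prod_group F T.
have G2F i : quot_iso (gamma G2 i) (gamma F i) by apply: quot_iso_prodl.
exists G1, G2; split; last split; last split; last split; last split; last split=> //.
- split; last exact/not_cyclic/G1F.
  by exists A, D => z; have [w ->] := G1w z; apply: word_gen.
- split; last exact: not_cyclic.
  exists (a, s : T), (b, t : T).
  apply: (prod_coprime_gen (q := q) _ _ am bn).
  + exact: free_prod_word am bn univ.
  + exact: Tw.
  + by rewrite fin_group_pow.
  + by rewrite fin_group_pow.
  + by rewrite -(exp1n l) ltn_exp2r // prime_gt1.
  + by rewrite -(exp1n k) ltn_exp2r // prime_gt1.
  + exact: prime_gt1.
  + exact: coprimeXl.
  + exact: coprimeXl.
- case=> f [fM [f' fK f'K]].
  (* An isomorphism [f] would carry the epimorphism [h] from [F] onto [S] to one from [G1]. The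
     images of [A] and [D] would then generate [S] and satisfy the relation that [v] was chosen to
     exclude. *)
  have [h [hM ha hb]] : exists h : F -> fin_group gT, [/\ is_hom h, h a = x & h b = y].
    by apply: (free_prod_lift univ); apply: pow_p => //; rewrite fin_group_pow.
  have gM : is_hom (h \o f) by move=> z z' /=; rewrite fM hM.
  have gE w : h (f (ev A D w)) = ev (h (f A)) (h (f D)) w by apply: (ev_hom A D w gM).
  apply: (vS (h (f A)) (h (f D))); last first.
    by rewrite -[ev _ _ v]gE -[gmul _ _]gM -homX // Bn hom1.
  have hS z : (h z : gT) \in S.
    have [w ->] := free_prod_word am bn univ z.
    rewrite (ev_hom _ _ _ hM) ha hb; apply: ev_mem; rewrite -xyS.
      by have [] := mem_gen_pair x y.
    by have [] := mem_gen_pair x y.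
  have hA z : (h z : gT) \in <<[set (h (f A) : gT); (h (f D) : gT)]>>%g.
    have [w ew] := G1w (f' z); rewrite -[z]f'K ew gE.
    by apply: ev_mem; have [] := mem_gen_pair (h (f A) : gT) (h (f D)).
  rewrite eqEsubset gen_subG subUset !sub1set !hS -xyS gen_subG subUset !sub1set.
  by rewrite -ha -hb !hA.
- exact: free_prod_not_iso_prod freeF s1.
- by move=> i i0; split=> //; apply: quot_iso_prodr => //; apply: G1F.
- by apply: (prod_not_residually_nilpotent Tperf (y := s)); apply/eqP.
Qed.
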